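(* For every prime number $p$, the integer \[Y(p):=\frac{1}{3}\left( (1+\sqrt{3}) \left( 2+\sqrt{3} \right)^{2p}+(1-\sqrt{3}) \left( 2-\sqrt{3} \right)^{2p}+1 \right)\] is composite. *)

(* Defs.v *)
From mathcomp Require Import all_boot all_order all_algebra.

Set Implicit Arguments.
Unset Strict Implicit.
Unset Printing Implicit Defensive.

Import Order.TTheory GRing.Theory Num.Theory.
Local Open Scope ring_scope.

Definition Y (R : rcfType) (p : nat) : R :=
  3^-1 * ((1 + Num.sqrt 3) * (2 + Num.sqrt 3) ^+ (2 * p)
          + (1 - Num.sqrt 3) * (2 - Num.sqrt 3) ^+ (2 * p) + 1).

Definition composite (n : nat) : Prop :=
  exists a b : nat, [/\ (1 < a)%N, (1 < b)%N & n = (a * b)%N].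

(* Main.v *)
Require Import Defs.
From mathcomp Require Import all_boot all_order all_algebra.
From mathcomp Require Import ring zify.

(** Write [(2 + sqrt 3)^(2n) = a + b sqrt 3]; then [Y n = (2a + 6b + 1) / 3].
    The sequence [Y n] is periodic modulo every integer.  Modulo 3 the period
    is 3 and [3 | Y n] when [n = 2 (mod 3)]; modulo 13 the period is 6 and
    [13 | Y n] when [n = 1 (mod 6)].  These classes contain every prime except
    3, and [Y 3 = 2461 = 23 * 107]. *)

Set Implicit Arguments.
Unset Strict Implicit.
Unset Printing Implicit Defensive.

Import Order.TTheory GRing.Theory Num.Theory.
Local Open Scope ring_scope.

(** [Ycoef n = (c, b)] encodes [(2 + sqrt 3)^(2n) = (3c + 1) + b sqrt 3]:
    the rational part is always [1] modulo [3], which makes [Y n] integral. *)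
Fixpoint Ycoef (n : nat) : nat * nat :=
  if n is m.+1 then
    let: (c, b) := Ycoef m in
    ((7 * c + 4 * b + 2)%N, (12 * c + 7 * b + 4)%N)
  else (0, 0)%N.

Definition Ynat (n : nat) : nat := (2 * (Ycoef n).1 + 2 * (Ycoef n).2 + 1)%N.

Lemma YcoefS n :
  Ycoef n.+1 = ((7 * (Ycoef n).1 + 4 * (Ycoef n).2 + 2)%N,
                (12 * (Ycoef n).1 + 7 * (Ycoef n).2 + 4)%N).
Proof. by rewrite /=; case: (Ycoef n). Qed.

(** Leaving [s] an arbitrary root of 3 covers both conjugates, [s = Num.sqrt 3] and
    [s = - Num.sqrt 3]. *)
Lemma expr_Ycoef (R : comNzRingType) (s : R) n : s ^+ 2 = 3 ->
  (2 + s) ^+ (2 * n) = 3 * (Ycoef n).1%:R + 1 + (Ycoef n).2%:R * s.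
Proof.
move=> s2; rewrite exprM; have -> : (2 + s) ^+ 2 = 7 + 4 * s by ring: s2.
elim: n => [|n IHn]; first by rewrite expr0 /=; ring.
by rewrite exprS IHn YcoefS /=; ring: s2.
Qed.

Lemma Y_Ynat (R : rcfType) n : Y R n = (Ynat n)%:R.
Proof.
have s2 : Num.sqrt (3 : R) ^+ 2 = 3 by rewrite sqr_sqrtr ?ler0n.
have Ns2 : (- Num.sqrt (3 : R)) ^+ 2 = 3 by rewrite sqrrN.
rewrite /Y (expr_Ycoef n s2) (expr_Ycoef n Ns2) /Ynat.
apply: (mulfI (x := 3 : R)); first by rewrite pnatr_eq0.
rewrite mulVKf ?pnatr_eq0 //.
by ring: s2.
Qed.

(** Three steps of the recurrence bring the state (0, 0) back to itself modulo 3. *)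
Lemma Ycoef_mod3 k :
  (3 %| (Ycoef (3 * k)).1)%N && (3 %| (Ycoef (3 * k)).2)%N.
Proof.
elim: k => [//|k]; rewrite mulnS /= -/(Ycoef (3 * k)).
case: (Ycoef (3 * k)) => c b /= /andP[/dvdnP[u ->] /dvdnP[v ->]].
by apply/andP; split; lia.
Qed.

Lemma Ycoef_mod13 k :
  (13 %| (Ycoef (6 * k)).1)%N && (13 %| (Ycoef (6 * k)).2)%N.
Proof.
elim: k => [//|k]; rewrite mulnS !addSn add0n; move: (6 * k)%N => n.
(* Naming the six successive states avoids unfolding their composite, whose size
   grows exponentially in the number of steps. *)
move: (YcoefS n) (YcoefS n.+1) (YcoefS n.+2) (YcoefS n.+3) (YcoefS n.+4)
  (YcoefS n.+4.+1).
move: (Ycoef n) (Ycoef n.+1) (Ycoef n.+2) (Ycoef n.+3) (Ycoef n.+4)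
  (Ycoef n.+4.+1) (Ycoef n.+4.+2).
move=> [c0 b0] [c1 b1] [c2 b2] [c3 b3] [c4 b4] [c5 b5] [c6 b6].
move=> /= [c1E b1E] [c2E b2E] [c3E b3E] [c4E b4E] [c5E b5E] [c6E b6E].
move=> /andP[/dvdnP[u c0E] /dvdnP[v b0E]].
by apply/andP; split; lia.
Qed.

(** By periodicity this reduces to [Ynat 2], which is 177 = 3 * 59. *)
Lemma dvd3_Ynat k : (3 %| Ynat (3 * k + 2))%N.
Proof.
have /andP[/dvdnP[u Eu] /dvdnP[v Ev]] := Ycoef_mod3 k.
by rewrite addn2 /Ynat !YcoefS /= Eu Ev; lia.
Qed.

Lemma dvd13_Ynat k : (13 %| Ynat (6 * k + 1))%N.
Proof.
have /andP[/dvdnP[u Eu] /dvdnP[v Ev]] := Ycoef_mod13 k.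
by rewrite addn1 /Ynat YcoefS /= Eu Ev; lia.
Qed.

(** Makes the divisors 3 and 13 proper; index 1 is excluded because [Ynat 1] is 13 itself. *)
Lemma Ynat_gt13 n : (1 < n)%N -> (13 < Ynat n)%N.
Proof. by case: n => [|[|n]] // _; rewrite /Ynat !YcoefS /=; lia. Qed.

Lemma composite_dvd d n : (1 < d < n)%N -> (d %| n)%N -> composite n.
Proof.
move=> /andP[d_gt1 d_ltn] /dvdnP[q nE]; exists q, d; split=> //.
by move: d_ltn; rewrite nE; case: q {nE} => [|[|q]] //; rewrite mul1n ltnn.
Qed.

Lemma prime_mod6 p : prime p ->
  [\/ p = 3, exists k, p = (3 * k + 2)%N | exists k, p = (6 * k + 1)%N].
Proof.
move=> p_pr.
have [/eqP p3|p_n3] := boolP (p == 3)%N; first by constructor 1.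
have n3p : ~~ (3 %| p)%N by rewrite dvdn_prime2 // eq_sym.
have [p_odd|p2] := boolP (odd p); last first.
  by constructor 2; exists 0; case: (even_prime p_pr) p2 => [|->].
have [pm|pm] := eqVneq (p %% 3)%N 2.
  by constructor 2; exists (p %/ 3)%N; lia.
(* Here [p] is odd and 1 modulo 3, hence 1 modulo 6. *)
by constructor 3; exists (p %/ 6)%N; lia.
Qed.

Theorem theorem1 (R : rcfType) (p : nat) (hp : prime p) :
  exists n : nat, Y R p = n%:R /\ composite n.
Proof.
exists (Ynat p); split; first exact: Y_Ynat.
have Y_gt13 := Ynat_gt13 (prime_gt1 hp).
case: (prime_mod6 hp) Y_gt13 => [->|[k ->]|[k ->]] Y_gt13.
- by apply: (@composite_dvd 23).
- by apply: (@composite_dvd 3); [lia | apply: dvd3_Ynat].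
- by apply: (@composite_dvd 13); [lia | apply: dvd13_Ynat].
Qed.
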